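(* Let $X$ be a real Banach space, and let $f:[a,b]\to X$ be continuous, of finite variation, and not constant on any (nondegenerate) subinterval of $[a,b]$. Let $x\in(a,b)$, $y=v_f(x)$, and $g=f\circ v_f^{-1}$. Then (i) if $x$ is a metrically regular point of $f$, then $md(g,y)=1$; (ii) if $x$ is a bilaterally metrically regular point of $f$, and there exists a neighbourhood $U$ of $x$ such that all $z\in U$ are metrically regular points of $f$, then $g$ is metrically differentiable at $y$.
   Context: $\bigvee_u^v f$ denotes the total variation of $f$ on $[u,v]$ for $u<v$, and $\bigvee_v^u f:=-\bigvee_u^v f$; $f$ has finite variation if $\bigvee_a^b f<\infty$. $v_f(x):=\bigvee_a^x f$ for $x\in[a,b]$; under the hypotheses $v_f$ is a homeomorphism of $[a,b]$ onto $[0,v_f(b)]$. A point $x\in[a,b]$ is a metrically regular point of $f$ if $\lim_{t\to0,\ x+t\in[a,b]}\frac{\|f(x+t)-f(x)\|}{\left|\bigvee_x^{x+t}f\right|}=1$. It is a bilaterally metrically regular point of $f$ if $\frac{\|f(u)-f(w)\|}{\bigvee_u^w f}\to1$ as $(u,w)\to(x,x)$ with $a\le u\le x\le w\le b$, $(u,w)\neq(x,x)$. For a mapping $g$ from an interval to $X$ and an interior point $y$, the metric derivative $md(g,y)$ is the common value of $\lim_{t\to0+}\frac{\|g(y+t)-g(y)\|}{t}$ and $\lim_{t\to0+}\frac{\|g(y-t)-g(y)\|}{t}$ if both limits exist and are equal (and finite). The mapping $g$ is metrically differentiable at $y$ if $md(g,y)$ exists and $\|g(s)-g(t)\|-md(g,y)|s-t|=o(|s-y|+|t-y|)$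 as $(s,t)\to(y,y)$. *)

(* Defs.v *)
From mathcomp Require Import all_boot all_order all_algebra.
From mathcomp Require Import all_classical all_reals all_analysis.
Set Implicit Arguments.
Unset Strict Implicit.
Unset Printing Implicit Defensive.
Import Order.TTheory GRing.Theory Num.Theory.
Import numFieldNormedType.Exports.
Local Open Scope classical_set_scope.
Local Open Scope ring_scope.

(* [variation] and [total_variation] from the library are restricted to real-
   valued functions; the next two definitions are the same, with values in a
   normed module. *)
Definition normed_variation (R : realType) (X : normedModType R)
    (a b : R) (f : R -> X) (s : seq R) : R :=
  let F := f \o nth b (a :: s) in
  \sum_(0 <= n < size s) `|F n.+1 - F n|.

Definition normed_total_variation (R : realType) (X : normedModType R)
    (a b : R) (f : R -> X) : \bar R :=
  ereal_sup [set (normed_variation a b f s)%:E | s in itv_partition a b].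

(* The oriented variation of f from u to v, as a real number. It is meaningful
   only where f has finite variation, since [fine] sends infinities to 0. *)
Definition oriented_variation (R : realType) (X : normedModType R)
    (f : R -> X) (u v : R) : R :=
  if u <= v then fine (normed_total_variation u v f)
  else - fine (normed_total_variation v u f).

Definition finite_variation (R : realType) (X : normedModType R)
    (a b : R) (f : R -> X) : Prop :=
  (normed_total_variation a b f < +oo)%E.

Definition nowhere_constant (R : realType) (X : normedModType R)
    (a b : R) (f : R -> X) : Prop :=
  forall c d : R, a <= c -> c < d -> d <= b ->
    ~ (exists k : X, forall z : R, z \in `[c, d] -> f z = k).

Definition variation_fun (R : realType) (X : normedModType R)
    (a : R) (f : R -> X) : R -> R :=
  oriented_variation f a.

Definition metrically_regular (R : realType) (X : normedModType R)
    (a b : R) (f : R -> X) (x : R) : Prop :=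
  x \in `[a, b] /\
  `|f (x + t) - f x| / `|oriented_variation f x (x + t)|
    @[t --> within [set t | x + t \in `[a, b]] 0^'] --> (1 : R).

Definition bilaterally_metrically_regular (R : realType) (X : normedModType R)
    (a b : R) (f : R -> X) (x : R) : Prop :=
  x \in `[a, b] /\
  `|f p.1 - f p.2| / oriented_variation f p.1 p.2
    @[p --> within [set p : R * R | a <= p.1 <= x /\ x <= p.2 <= b
                                    /\ p <> (x, x)] (nbhs (x, x))] --> (1 : R).

(* [is_md g y m]: the metric derivative md(g, y) exists and equals m. The point
   y must be interior to the domain on which g is of interest; the values of g
   away from y do not matter. *)
Definition is_md (R : realType) (X : normedModType R)
    (g : R -> X) (y m : R) : Prop :=
  (`|g (y + t) - g y| / t @[t --> 0^'+] --> m) /\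
  (`|g (y - t) - g y| / t @[t --> 0^'+] --> m).

Definition metrically_differentiable (R : realType) (X : normedModType R)
    (g : R -> X) (y : R) : Prop :=
  exists2 m : R, is_md g y m &
    (fun p : R * R => `|g p.1 - g p.2| - m * `|p.1 - p.2|)
      =o_ (nbhs (y, y)) (fun p : R * R => `|p.1 - y| + `|p.2 - y|).

(* Main.v *)
Require Import Defs.
From mathcomp Require Import all_boot all_order all_algebra.
From mathcomp Require Import all_classical all_reals all_analysis.
From mathcomp Require Import lra.
Import Order.TTheory GRing.Theory Num.Theory.
Import numFieldNormedType.Exports.
Local Open Scope classical_set_scope.
Local Open Scope ring_scope.

(* The variation [v] of [f] is additive, strictly increasing and continuous, so
   near [y = v x] it has a continuous inverse [w], and the variation of [f]
   between [w p] and [w q] is [q - p]. Thus [g = f \o w] is 1-Lipschitz, and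
   regularity of [f] at [x] says that [`|g p - g q| / `|p - q|] tends to 1: with
   [q = y] for (i), and over pairs with [p <= y <= q] for the bilateral notion.
   In (ii), a pair on one side of [y] is handled by the reverse triangle
   inequality through [y]: for [y <= p <= q],
   [`|g q - g p| >= `|g q - g y| - `|g p - g y| >= (1 - e) * (q - y) - (p - y)
    = (q - p) - e * (q - y)]. *)

Section variation.
Set Implicit Arguments.
Unset Strict Implicit.
Unset Printing Implicit Defensive.
Context {R : realType} {X : normedModType R}.
Implicit Types (f : R -> X) (a b c u w z : R) (s t : seq R).

Lemma normed_variation_nil a b f : normed_variation a b f [::] = 0.
Proof. by rewrite /normed_variation big_nil. Qed.

Lemma normed_variation_cons a b f z s :
  normed_variation a b f (z :: s) = `|f z - f a| + normed_variation z b f s.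
Proof. by rewrite /normed_variation /= big_nat_recl. Qed.

Lemma normed_variation_le_TV a b f s : itv_partition a b s ->
  ((normed_variation a b f s)%:E <= normed_total_variation a b f)%E.
Proof. by move=> abs; apply: ereal_sup_ubound; exists s. Qed.

Lemma normed_TV_xx a f : normed_total_variation a a f = 0%E.
Proof.
apply/eqP; rewrite eq_le; apply/andP; split.
  apply: ge_ereal_sup => _ [s /itv_partitionxx -> <-].
  by rewrite normed_variation_nil.
have := @normed_variation_le_TV a a f [::]; rewrite normed_variation_nil.
by apply; split => /=.
Qed.

Lemma normed_TV_ge_dist a b f : a <= b ->
  (`|f b - f a|%:E <= normed_total_variation a b f)%E.
Proof.
rewrite le_eqVlt => /predU1P[<-|ab]; first by rewrite subrr normr0 normed_TV_xx.
rewrite -[`|_|]addr0 -(normed_variation_nil b b f) -normed_variation_cons.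
exact/normed_variation_le_TV/itv_partition1.
Qed.

Lemma normed_TV_ge0 a b f : a <= b -> (0 <= normed_total_variation a b f)%E.
Proof. by move=> /(normed_TV_ge_dist f); apply: le_trans. Qed.

Lemma dist_add_normed_TV_le a b c f : a < b ->
  (`|f b - f a|%:E + normed_total_variation b c f <=
   normed_total_variation a c f)%E.
Proof.
move=> ab; rewrite -leeBrDl//; apply: ge_ereal_sup => _ [s [bs sc] <-].
rewrite leeBrDl// -EFinD.
suff -> : `|f b - f a| + normed_variation b c f s = normed_variation a c f (b :: s).
  by apply: normed_variation_le_TV; split => //=; rewrite ab.
by rewrite normed_variation_cons.
Qed.

Lemma normed_variation_add_TV_le a b c f s : itv_partition a b s ->
  ((normed_variation a b f s)%:E + normed_total_variation b c f <=
   normed_total_variation a c f)%E.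
Proof.
elim: s a => [a /itv_partition_nil ->|h s ih a abs].
  by rewrite normed_variation_nil add0e.
rewrite normed_variation_cons EFinD -addeA.
apply: (le_trans (leeD2l _ (ih _ (itv_partition_cons abs)))).
by apply: dist_add_normed_TV_le; case: abs => /= /andP[].
Qed.

Lemma normed_variation_le_TVD a b c f s : a <= c -> c <= b ->
  itv_partition a b s -> ((normed_variation a b f s)%:E <=
    normed_total_variation a c f + normed_total_variation c b f)%E.
Proof.
elim: s a => [a ac cb _|h s ih a ac cb abs].
  by rewrite normed_variation_nil adde_ge0// normed_TV_ge0.
have hbs := itv_partition_cons abs.
have ah : a < h by case: abs => /= /andP[].
rewrite normed_variation_cons EFinD; have [hc|ch] := leP h c.
  apply: (le_trans (leeD2l _ (ih _ hc cb hbs))).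
  by rewrite addeA leeD2r// dist_add_normed_TV_le.
apply: (@le_trans _ _ (`|f c - f a|%:E + (normed_variation c b f (h :: s))%:E)%E).
  by rewrite normed_variation_cons -!EFinD lee_fin addrA lerD2r [leRHS]addrC
             ler_distD.
apply: leeD; first exact: normed_TV_ge_dist.
by apply: normed_variation_le_TV; case: hbs => hs sb; split => //=; rewrite ch.
Qed.

Lemma normed_TVD a b c f : a <= c -> c <= b ->
  normed_total_variation a b f =
  (normed_total_variation a c f + normed_total_variation c b f)%E.
Proof.
move=> ac cb; apply/eqP; rewrite eq_le; apply/andP; split.
  by apply: ge_ereal_sup => _ [s abs <-]; exact: normed_variation_le_TVD.
have [cbfin|] := boolP (normed_total_variation c b f \is a fin_num).
  rewrite -leeBrDr//; apply: ge_ereal_sup => _ [s acs <-].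
  by rewrite leeBrDr// normed_variation_add_TV_le.
rewrite ge0_fin_numE ?normed_TV_ge0// -leNgt leye_eq => /eqP cby.
have := ac; rewrite [a <= c]le_eqVlt => /predU1P[->|{}ac].
  by rewrite normed_TV_xx add0e.
by have := normed_variation_add_TV_le b f (itv_partition1 ac);
rewrite cby addey// leye_eq => /eqP->; rewrite leey.
Qed.

Lemma normed_variation_split_right a b f s : a < b -> itv_partition a b s ->
  exists2 c, a < c <= b & forall z, a < z < c -> ((normed_variation a b f s)%:E <=
    `|f z - f a|%:E + normed_total_variation z b f)%E.
Proof.
move=> ab; case: s => [/itv_partition_nil abE|h s abs].
  by rewrite abE ltxx in ab.
have hbs := itv_partition_cons abs.
exists h; first by rewrite (itv_partition_le hbs) andbT; case: abs => /= /andP[].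
move=> z /andP[az zh].
apply: (@le_trans _ _ (`|f z - f a|%:E + (normed_variation z b f (h :: s))%:E)%E).
  by rewrite !normed_variation_cons -!EFinD lee_fin addrA lerD2r [leRHS]addrC
             ler_distD.
rewrite leeD2l// normed_variation_le_TV//.
by case: hbs => hs sb; split => //=; rewrite zh.
Qed.

Lemma normed_variation_split_left a b f s : a < b -> itv_partition a b s ->
  exists2 c, a <= c < b & forall z, c < z < b -> ((normed_variation a b f s)%:E <=
    normed_total_variation a z f + `|f b - f z|%:E)%E.
Proof.
elim: s a => [a ab /itv_partition_nil abE|h s ih a ab abs].
  by rewrite abE ltxx in ab.
have hbs := itv_partition_cons abs.
have ah : a < h by case: abs => /= /andP[].
rewrite normed_variation_cons.
have := itv_partition_le hbs; rewrite le_eqVlt => /predU1P[hb|hb].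
  exists a; rewrite ?lexx// => z /andP[az _].
  move: hbs; rewrite -hb => /itv_partitionxx ->.
  rewrite normed_variation_nil addr0.
  apply: (@le_trans _ _ (`|f z - f a|%:E + `|f h - f z|%:E)%E).
    by rewrite -EFinD lee_fin [leRHS]addrC ler_distD.
  by rewrite leeD2r// normed_TV_ge_dist// ltW.
have [c /andP[hc cb] cP] := ih _ hb hbs.
exists c; first by rewrite cb (le_trans (ltW ah)).
move=> z czb; rewrite EFinD.
apply: (le_trans (leeD2l _ (cP _ czb))); rewrite addeA leeD2r//.
exact: dist_add_normed_TV_le.
Qed.

End variation.

Section variation_fun.
Set Implicit Arguments.
Unset Strict Implicit.
Unset Printing Implicit Defensive.
Context {R : realType} {X : normedModType R}.
Variables (a b : R) (f : R -> X).
Hypothesis f_fv : finite_variation a b f.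
Local Notation v := (variation_fun a f).
Implicit Types u w z : R.

Lemma normed_TV_fin u w : a <= u -> u <= w -> w <= b ->
  normed_total_variation u w f \is a fin_num.
Proof.
move=> au uw wb; rewrite ge0_fin_numE ?normed_TV_ge0//.
apply: le_lt_trans f_fv.
rewrite (normed_TVD f au (le_trans uw wb)) (normed_TVD f uw wb).
by rewrite addeCA leeDl// adde_ge0// normed_TV_ge0.
Qed.

Lemma normed_TVE u w : a <= u -> u <= w -> w <= b ->
  normed_total_variation u w f = (v w - v u)%:E.
Proof.
move=> au uw wb; rewrite /v /oriented_variation au (le_trans au uw).
rewrite (normed_TVD f au uw) fineD ?normed_TV_fin ?(le_trans uw)//.
by rewrite addrAC subrr add0r fineK// normed_TV_fin.
Qed.

Lemma oriented_variationE u w : a <= u <= b -> a <= w <= b ->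
  oriented_variation f u w = v w - v u.
Proof.
move=> /andP[au ub] /andP[aw wb]; rewrite /oriented_variation.
have [uw|/ltW wu] := leP u w; first by rewrite normed_TVE.
by rewrite normed_TVE//= opprB.
Qed.

Lemma dist_le_variation_fun u w : a <= u -> u <= w -> w <= b ->
  `|f w - f u| <= v w - v u.
Proof. by move=> ? ? ?; rewrite -lee_fin -normed_TVE// normed_TV_ge_dist. Qed.

Lemma variation_fun_nondecreasing u w : a <= u -> u <= w -> w <= b -> v u <= v w.
Proof.
move=> ? ? ?; rewrite -subr_ge0.
by apply: le_trans (dist_le_variation_fun _ _ _).
Qed.

Lemma variation_fun_increasing : nowhere_constant a b f ->
  forall u w, a <= u -> u < w -> w <= b -> v u < v w.
Proof.
move=> f_nc u w au uw wb; rewrite lt_neqAle variation_fun_nondecreasing// ?ltW//.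
rewrite andbT; apply/eqP => vuw; apply: (f_nc u w au uw wb).
exists (f u) => z; rewrite in_itv/= => /andP[uz zw].
apply/eqP; rewrite -subr_eq0 -normr_le0.
apply: (le_trans (dist_le_variation_fun au uz (le_trans zw wb))).
by rewrite vuw subr_le0 variation_fun_nondecreasing// (le_trans au).
Qed.

Lemma variation_fun_right_continuous u : a <= u < b ->
  f @ u^'+ --> f u -> v @ u^'+ --> v u.
Proof.
move=> /andP[au ub] fu; apply/cvgrPdist_lt => e e0.
have e20 : 0 < e / 2 by rewrite divr_gt0.
have ubfin := normed_TV_fin au (ltW ub) (lexx b).
have [_ [s ubs <-]] := ub_ereal_sup_adherent e20 ubfin.
have [c /andP[uc cb] cP] := normed_variation_split_right f ub ubs.
move=> vs; near=> z.
have uz : u < z by near: z; exact: nbhs_right_gt.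
have zc : z < c by near: z; exact: nbhs_right_lt.
have zb : z <= b by rewrite (le_trans (ltW zc)).
have fzu : `|f u - f z| < e / 2.
  by near: z; move/cvgrPdist_lt : fu; exact.
have := cP z; rewrite uz zc => /(_ isT) /(lt_le_trans vs).
rewrite -/(normed_total_variation u b f).
rewrite !normed_TVE// ?(le_trans au)// ?(ltW uz)// ?(ltW ub)//.
rewrite -EFinB -EFinD lte_fin => H.
rewrite distrC ger0_norm ?subr_ge0 ?variation_fun_nondecreasing// ?(ltW uz)//.
rewrite distrC in fzu.
move: H fzu; lra.
Unshelve. all: by end_near. Qed.

Lemma variation_fun_left_continuous u : a < u <= b ->
  f @ u^'- --> f u -> v @ u^'- --> v u.
Proof.
move=> /andP[au ub] fu; apply/cvgrPdist_lt => e e0.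
have e20 : 0 < e / 2 by rewrite divr_gt0.
have aufin := normed_TV_fin (lexx a) (ltW au) ub.
have [_ [s aus <-]] := ub_ereal_sup_adherent e20 aufin.
have [c /andP[ac cu] cP] := normed_variation_split_left f au aus.
move=> vs; near=> z.
have zu : z < u by near: z; exact: nbhs_left_lt.
have cz : c < z by near: z; exact: nbhs_left_gt.
have az : a <= z by rewrite (le_trans ac)// ltW.
have fzu : `|f u - f z| < e / 2.
  by near: z; move/cvgrPdist_lt : fu; exact.
have := cP z; rewrite zu cz => /(_ isT) /(lt_le_trans vs).
rewrite -/(normed_total_variation a u f).
rewrite !normed_TVE// ?(ltW au)// ?(le_trans (ltW zu))//.
rewrite -EFinB -EFinD lte_fin => H.
rewrite ger0_norm ?subr_ge0 ?variation_fun_nondecreasing// ?(ltW zu)//.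
move: H fzu; lra.
Unshelve. all: by end_near. Qed.

Lemma variation_fun_continuous : {within `[a, b], continuous f} ->
  {in `]a, b[, continuous v}.
Proof.
move=> f_cont u uab; have /andP[au ub] : a < u < b by move: uab; rewrite in_itv.
have [fi _ _] := (continuous_within_itvP f (lt_trans au ub)).1 f_cont.
have [fl fr] := (left_right_continuousP f u).2 (fi _ uab).
apply/left_right_continuousP; split.
  by apply: variation_fun_left_continuous; rewrite // au ltW.
by apply: variation_fun_right_continuous; rewrite // ub ltW.
Qed.

End variation_fun.

Section metric_derivative.
Set Implicit Arguments.
Unset Strict Implicit.
Unset Printing Implicit Defensive.
Context {R : realType} {X : normedModType R}.
Implicit Types (g : R -> X) (y m : R).

Lemma is_md_dnbhs g y m :
  `|g p - g y| / `|p - y| @[p --> y^'] --> m -> is_md g y m.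
Proof.
move=> gm; split; apply/cvgrPdist_lt => e e0;
  move/cvgrPdist_lt : gm => /(_ e e0) /nbhs_ballP[d d0 dP]; near=> t.
- have t0 : 0 < t by near: t; exact: nbhs_right_gt.
  have td : t < d by near: t; exact: nbhs_right_lt.
  have ytE : y + t - y = t by rewrite addrAC subrr add0r.
  have := dP (y + t); rewrite /ball/= distrC ytE gtr0_norm//; apply => //.
  by rewrite -subr_eq0 ytE gt_eqF.
- have t0 : 0 < t by near: t; exact: nbhs_right_gt.
  have td : t < d by near: t; exact: nbhs_right_lt.
  have ytE : y - t - y = - t by rewrite addrAC subrr add0r.
  have := dP (y - t); rewrite /ball/= distrC ytE normrN gtr0_norm//; apply => //.
  by rewrite -subr_eq0 ytE oppr_eq0 gt_eqF.
Unshelve. all: by end_near. Qed.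

Lemma metrically_differentiable_straddle g y : is_md g y 1 ->
  (\forall p \near y & q \near y, `|g p - g q| <= `|p - q|) ->
  (forall e, 0 < e -> \forall p \near y & q \near y,
     p <= y -> y <= q -> (1 - e) * (q - p) <= `|g p - g q|) ->
  metrically_differentiable g y.
Proof.
move=> md1 lip str; exists 1 => //; apply/eqoP => e e0.
have near_sym (P : R -> R -> Prop) :
    (\forall p \near y & q \near y, P p q) ->
    exists2 d, 0 < d & forall p q, `|y - p| < d -> `|y - q| < d -> P p q.
  move=> yyP; have /nbhs_ballP[d /= d0 dP] :
      \forall pq \near (y, y), P pq.1 pq.2 by exact: yyP.
  exists d => // p q yp yq.
  by apply: (dP (p, q)); split.
have [d1 d10 {}lip] := near_sym _ lip.
have [d2 d20 {}str] := near_sym _ (str _ e0).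
have yd2 : `|y - y| < d2 by rewrite subrr normr0.
suff H p q : `|y - p| < d1 -> `|y - q| < d1 -> `|y - p| < d2 -> `|y - q| < d2 ->
    p <= q -> (q - p) - `|g p - g q| <= e * (`|p - y| + `|q - y|).
  have near_lt d : 0 < d ->
      \forall pq \near (y, y), `|y - pq.1| < d /\ `|y - pq.2| < d.
    by move=> d0; apply/nbhs_ballP; exists d.
  near=> pq; rewrite mul1r.
  have [p1 q1] : `|y - pq.1| < d1 /\ `|y - pq.2| < d1.
    by near: pq; exact: near_lt.
  have [p2 q2] : `|y - pq.1| < d2 /\ `|y - pq.2| < d2.
    by near: pq; exact: near_lt.
  rewrite ler0_norm ?subr_le0 ?lip// opprB.
  rewrite [leRHS](_ : _ = e * (`|pq.1 - y| + `|pq.2 - y|)); last first.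
    by rewrite ger0_norm// addr_ge0.
  have [pq12|/ltW pq21] := leP pq.1 pq.2.
    by rewrite distrC ger0_norm ?subr_ge0// H.
  by rewrite ger0_norm ?subr_ge0// [X in _ - X]distrC [X in _ * X]addrC H.
move=> p1 q1 p2 q2 pq.
have [yp|/ltW py] := leP y p.
  have yq := le_trans yp pq.
  have yp0 : 0 <= p - y by rewrite subr_ge0.
  have yq0 : 0 <= q - y by rewrite subr_ge0.
  have := str y q yd2 q2 (lexx y) yq.
  have := lip p y p1; rewrite subrr normr0 => /(_ d10).
  have := ler_distD (g p) (g q) (g y).
  have := mulr_ge0 (ltW e0) yp0.
  rewrite (distrC (g q) (g y)) (distrC (g q) (g p)).
  by rewrite (ger0_norm yp0) (ger0_norm yq0); lra.
have py0 : p - y <= 0 by rewrite subr_le0.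
rewrite (ler0_norm py0); have [yq|/ltW qy] := leP y q.
  have yq0 : 0 <= q - y by rewrite subr_ge0.
  by have := str p q p2 q2 py yq; rewrite (ger0_norm yq0); lra.
have qy0 : q - y <= 0 by rewrite subr_le0.
have := str p y p2 yd2 py (lexx y).
have := lip q y q1; rewrite subrr normr0 => /(_ d10).
have := ler_distD (g q) (g p) (g y).
have : 0 <= e * (y - q) by rewrite mulr_ge0 ?subr_ge0// ltW.
by rewrite (ler0_norm qy0); lra.
Unshelve. all: by end_near. Qed.

End metric_derivative.

Section variation_inverse.
Set Implicit Arguments.
Unset Strict Implicit.
Unset Printing Implicit Defensive.
Context {R : realType} {X : normedModType R}.
Variables (a b : R) (f : R -> X) (x : R).
Hypothesis f_cont : {within `[a, b], continuous f}.
Hypothesis f_fv : finite_variation a b f.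
Hypothesis f_nc : nowhere_constant a b f.
Hypothesis x_ab : x \in `]a, b[.
Local Notation v := (variation_fun a f).
Local Notation w := (pinv `[a, b] v).
Local Notation y := (v x).
Local Notation g := (f \o w).

Lemma variation_funK : {in `[a, b], cancel v w}.
Proof.
move=> u uab; apply: pinvKV; last by rewrite inE.
move=> {uab}u z; rewrite !inE/= !in_itv/= => /andP[au ub] /andP[az zb] vuz.
apply/eqP; rewrite eq_le !leNgt; apply/andP; split; apply/negP => uz.
  by have := variation_fun_increasing f_fv f_nc az uz ub; rewrite vuz ltxx.
by have := variation_fun_increasing f_fv f_nc au uz zb; rewrite vuz ltxx.
Qed.

Lemma near_variation_inv : w z @[z --> y] --> x /\ \forall z \near y, v (w z) = z.
Proof.
have wvK : {near x, cancel v w}.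
  near=> u; apply: variation_funK; apply: subset_itv_oo_cc.
  by near: u; exact: near_in_itvoo.
have vC : {near x, continuous v}.
  near=> u; apply: (variation_fun_continuous f_fv f_cont).
  by near: u; exact: near_in_itvoo.
split; last exact: near_continuous_can_sym vC wvK.
rewrite -[in X in _ --> X](nbhs_singleton wvK).
exact: (nbhs_singleton (near_can_continuous wvK vC)).
Unshelve. all: by end_near. Qed.

Lemma variation_inv_center : w y = x.
Proof. exact/variation_funK/subset_itv_oo_cc. Qed.

Lemma near_variation_inv_in : \forall z \near y, a <= w z <= b.
Proof.
have [wx _] := near_variation_inv.
have : \forall u \near x, a <= u <= b.
  near=> u; have : u \in `]a, b[ by near: u; exact: near_in_itvoo.
  by rewrite in_itv => /andP[/ltW-> /ltW->].
exact: wx.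
Unshelve. all: by end_near. Qed.

Lemma metrically_regular_is_md : metrically_regular a b f x -> is_md g y 1.
Proof.
move=> [_ fx]; apply: is_md_dnbhs.
have [wx vwK] := near_variation_inv.
have xab : a <= x <= b by move: x_ab; rewrite in_itv/= => /andP[/ltW-> /ltW->].
apply/cvgrPdist_lt => e e0.
move/cvgrPdist_lt : fx => /(_ e e0) /nbhs_ballP[d /= d0 dP].
have wd : \forall p \near y, `|x - w p| < d by move/cvgrPdist_lt : wx; exact.
near=> p.
have vwp : v (w p) = p by near: p; apply: cvg_within.
have wab : a <= w p <= b.
  by near: p; apply: cvg_within; exact: near_variation_inv_in.
have py : p != y by near: p; exact: nbhs_dnbhs_neq.
have := dP (w p - x); rewrite /ball/= sub0r normrN distrC.
have -> : x + (w p - x) = w p by rewrite addrC subrK.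
rewrite (oriented_variationE f_fv)// vwp variation_inv_center; apply.
- by near: p; apply: cvg_within.
- by rewrite subr_eq0; apply: contra_neq py => wpx; rewrite -vwp wpx.
- by rewrite in_itv.
Unshelve. all: by end_near. Qed.

Lemma near_variation_inv_lipschitz :
  \forall p \near y & q \near y, `|g p - g q| <= `|p - q|.
Proof.
have [_ vwK] := near_variation_inv.
have H : \forall p \near y, v (w p) = p /\ a <= w p <= b.
  by apply: filterS2 vwK near_variation_inv_in.
near=> p q => /=.
have [vp /andP[ap pb]] : v (w p) = p /\ a <= w p <= b by near: p.
have [vq /andP[aq qb]] : v (w q) = q /\ a <= w q <= b by near: q.
have [pq|/ltW qp] := leP (w p) (w q).
  rewrite distrC -{2}vp -{2}vq [leRHS]distrC (le_trans _ (ler_norm _))//.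
  exact: (dist_le_variation_fun f_fv).
rewrite -{2}vp -{2}vq (le_trans _ (ler_norm _))//.
exact: (dist_le_variation_fun f_fv).
Unshelve. all: by end_near. Qed.

Lemma bilaterally_metrically_regular_straddle e :
  bilaterally_metrically_regular a b f x -> 0 < e ->
  \forall p \near y & q \near y,
    p <= y -> y <= q -> (1 - e) * (q - p) <= `|g p - g q|.
Proof.
move=> [_ fx] e0; have [wx vwK] := near_variation_inv.
have xab : a <= x <= b by move: x_ab; rewrite in_itv/= => /andP[/ltW-> /ltW->].
have /andP[ax xb] := xab.
move/cvgrPdist_lt : fx => /(_ e e0) /nbhs_ballP[d /= d0 dP].
have wd : \forall p \near y, `|x - w p| < d by move/cvgrPdist_lt : wx; exact.
have H : \forall p \near y, [/\ v (w p) = p, a <= w p <= b & `|x - w p| < d].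
  by apply: filterS3 vwK near_variation_inv_in wd.
near=> p q => /= py yq.
have [vp /andP[ap pb] pd] : [/\ v (w p) = p, a <= w p <= b & `|x - w p| < d].
  by near: p.
have [vq /andP[aq qb] qd] : [/\ v (w q) = q, a <= w q <= b & `|x - w q| < d].
  by near: q.
have [<-|pq] := eqVneq p q; first by rewrite !subrr mulr0.
have {}pq : p < q by rewrite lt_neqAle pq (le_trans py).
have px : w p <= x.
  rewrite leNgt; apply/negP => /(variation_fun_increasing f_fv f_nc ax)/(_ pb).
  by rewrite vp ltNge py.
have xq : x <= w q.
  rewrite leNgt; apply/negP => /(variation_fun_increasing f_fv f_nc aq)/(_ xb).
  by rewrite vq ltNge yq.
have := dP (w p, w q); rewrite /= (oriented_variationE f_fv) ?ap ?aq// vp vq.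
move=> /(_ _ _)/ltW.
rewrite ler_distlC => H1.
have /andP[+ _] : 1 - e <= `|f (w p) - f (w q)| / (q - p) <= 1 + e.
  apply: H1; first by split.
  split; [by apply/andP|split; [by apply/andP|move=> [pxE qxE]]].
  by move: pq; rewrite -vp -vq pxE qxE ltxx.
by rewrite ler_pdivlMr// subr_gt0.
Unshelve. all: by end_near. Qed.

End variation_inverse.

Theorem lemma5p3 (R : realType) (X : completeNormedModType R) (a b : R)
    (f : R -> X)
    (f_cont : {within `[a, b], continuous f})
    (f_fv : finite_variation a b f)
    (f_nc : nowhere_constant a b f)
    (x : R) (x_ab : x \in `]a, b[) :
  let v_f := variation_fun a f in
  let y := v_f x in
  let g := f \o pinv `[a, b] v_f in
  (metrically_regular a b f x -> is_md g y 1) /\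
  (bilaterally_metrically_regular a b f x ->
   (exists U : set R, nbhs x U /\
      forall z : R, U z -> metrically_regular a b f z) ->
   metrically_differentiable g y).
Proof.
move=> v_f y g; split; first exact: metrically_regular_is_md.
move=> bx [U [xU Ureg]]; apply: metrically_differentiable_straddle.
- exact: metrically_regular_is_md (Ureg _ (nbhs_singleton xU)).
- exact: near_variation_inv_lipschitz.
- by move=> e; exact: bilaterally_metrically_regular_straddle.
Qed.
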